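(* For each natural number $k<\omega$, the bimodal logics $\mathrm{K}^{\neq}+\chi_k$ and $\mathrm{KB}^{\neq}+\chi_k$ have the exponential finite model property and are decidable.
   Context: Bimodal formulas are built from countably many propositional variables $p_0,p_1,\dots$ with $\bot,\to$ and two unary modalities $\lozenge$ and $\langle\neq\rangle$ (boxes $\Box,[\neq]$ are their duals). Abbreviations: $\exists\varphi := \langle\neq\rangle\varphi\vee\varphi$ and $\forall\varphi := [\neq]\varphi\wedge\varphi$. Formulas are interpreted in Kripke frames $(X,R,D)$ (with $\lozenge$ interpreted by $R$ and $\langle\neq\rangle$ by $D$) in the standard way. A normal (bimodal or unimodal) logic is a set of formulas containing all classical tautologies, $\neg\lozenge_i\bot$ and $\lozenge_i(p_0\vee p_1)\to\lozenge_i p_0\vee\lozenge_i p_1$ for each modality, closed under modus ponens, substitution and monotonicity ($\varphi\to\psi\in L$ implies $\lozenge_i\varphi\to\lozenge_i\psi\in L$); $L+\Phi$ is the smallest normal logic containing $L\cup\Phi$. $\mathrm{K}$ is the smallest normal unimodal logic and $\mathrm{KB}=\mathrm{K}+(p\to\Box\lozenge p)$. For a unimodal logic $L$, $L^{\neq}$ is the smallest normal bimodal logic containing $L$ (in the modality $\lozenge$) and the formulas $p\to[\neq]\langle\neq\rangle p$, $\langle\neq\rangle\langle\neq\rangle p\to\exists p$, and $\lozenge p\to\exists p$. For $k<\omega$, $\chi_k$ is the formula $$\forall \bigvee_{i<k}\Big(p_i\wedge\bigwedge_{i\neq j<k}\neg p_j\Big)\to \exists\bigvee_{i<k}(p_i\wedge\lozenge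 p_i).$$ A logic $L$ has the exponential finite model property if every formula $\varphi\notin L$ is falsified in some frame validating $L$ whose domain has at most $2^{n}$ elements, where $n$ is the number of subformulas of $\varphi$. *)

(* Defs.v *)
From HB Require Import structures.
From mathcomp Require Import zify.
From mathcomp Require Import all_boot.

Set Implicit Arguments.
Unset Strict Implicit.
Unset Printing Implicit Defensive.

(** * Modal formulas over a set [M] of unary modalities *)

Inductive form (M : Type) : Type :=
| Var (i : nat)
| Bot
| Imp (a b : form M)
| Dia (m : M) (a : form M).

Arguments Var {M}.
Arguments Bot {M}.

Section Connectives.
Variable M : Type.
Implicit Types (a b : form M) (m : M).

Definition Neg a : form M := Imp a Bot.
Definition Top : form M := Neg Bot.
Definition Or a b : form M := Imp (Neg a) b.
Definition And a b : form M := Neg (Imp a (Neg b)).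
Definition Box m a : form M := Neg (Dia m (Neg a)).

Fixpoint subst (s : nat -> form M) a : form M :=
  match a with
  | Var i => s i
  | Bot => Bot
  | Imp a b => Imp (subst s a) (subst s b)
  | Dia m a => Dia m (subst s a)
  end.

End Connectives.

Arguments Top {M}.

Fixpoint map_mod (M N : Type) (f : M -> N) (a : form M) : form N :=
  match a with
  | Var i => Var i
  | Bot => Bot
  | Imp a b => Imp (map_mod f a) (map_mod f b)
  | Dia m a => Dia (f m) (map_mod f a)
  end.

Lemma form_eq_dec (M : eqType) (a b : form M) : {a = b} + {a <> b}.
Proof. by decide equality; [exact: eq_comparable | exact: eq_comparable]. Qed.

HB.instance Definition _ (M : eqType) :=
  hasDecEq.Build (form M) (compareP (@form_eq_dec M)).

Fixpoint subforms (M : Type) (a : form M) : seq (form M) :=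
  a :: match a with
       | Var _ | Bot => [::]
       | Imp b c => subforms b ++ subforms c
       | Dia _ b => subforms b
       end.

(* Subformulas are counted without repetition. *)
Definition num_subforms (M : eqType) (a : form M) : nat :=
  size (undup (subforms a)).

(** * Normal logics *)

Definition logic (M : Type) : Type := form M -> Prop.

(* Truth-functional value of a formula whose variables and formulas of the
   form [Dia m a] are all treated as atoms, with values given by [v]. *)
Fixpoint bool_val (M : Type) (v : form M -> bool) (a : form M) : bool :=
  match a with
  | Bot => false
  | Imp b c => bool_val v b ==> bool_val v c
  | Var _ | Dia _ _ => v a
  end.

Definition tautology (M : Type) (a : form M) : Prop :=
  forall v, bool_val v a.

Record normal (M : Type) (L : logic M) : Prop := {
  normal_taut : forall a, tautology a -> L a;
  normal_bot : forall m, L (Neg (Dia m Bot));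
  normal_or : forall m,
    L (Imp (Dia m (Or (Var 0) (Var 1)))
           (Or (Dia m (Var 0)) (Dia m (Var 1))));
  normal_mp : forall a b, L (Imp a b) -> L a -> L b;
  normal_subst : forall s a, L a -> L (subst s a);
  normal_mono : forall m a b, L (Imp a b) -> L (Imp (Dia m a) (Dia m b))
}.

Definition least_normal (M : Type) (S : logic M) : logic M :=
  fun a => forall L, normal L -> (forall b, S b -> L b) -> L a.

Lemma least_normal_normal (M : Type) (S : logic M) : normal (least_normal S).
Proof.
split=> [a Ta|m|m|a b Lab La|s a La|m a b Lab] L nL SL; have [*] := nL; auto.
- by apply: (normal_mp nL (Lab L nL SL)); apply: La.
- by apply: (normal_subst nL); apply: La.
- by apply: (normal_mono nL); apply: Lab.
Qed.

Definition plus (M : Type) (L S : logic M) : logic M :=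
  least_normal (fun a => L a \/ S a).

(** * The logics of the difference modality *)

Definition unimod : Type := unit.

Inductive bimod : Type := ModR | ModD.

Definition bimod_eq_dec (m n : bimod) : {m = n} + {m <> n}.
Proof. by decide equality. Defined.

HB.instance Definition _ := hasDecEq.Build bimod (compareP bimod_eq_dec).

Definition logicK : logic unimod := least_normal (fun _ => False).

Definition axB : form unimod := Imp (Var 0) (Box tt (Dia tt (Var 0))).

Definition logicKB : logic unimod := plus logicK (eq axB).

Definition Ex (a : form bimod) : form bimod := Or (Dia ModD a) a.
Definition All (a : form bimod) : form bimod := And (Box ModD a) a.

Definition neq_axiom (a : form bimod) : Prop :=
  [\/ a = Imp (Var 0) (Box ModD (Dia ModD (Var 0))),
      a = Imp (Dia ModD (Dia ModD (Var 0))) (Ex (Var 0))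
    | a = Imp (Dia ModR (Var 0)) (Ex (Var 0))].

Definition neq_logic (L : logic unimod) : logic bimod :=
  least_normal (fun a =>
    (exists2 b, L b & a = map_mod (fun _ => ModR) b) \/ neq_axiom a).

Definition chi (k : nat) : form bimod :=
  Imp
    (All (\big[@Or bimod/Bot]_(i < k)
            And (Var i) (\big[@And bimod/Top]_(j < k | i != j) Neg (Var j))))
    (Ex (\big[@Or bimod/Bot]_(i < k) And (Var i) (Dia ModR (Var i)))).

(** * Kripke semantics *)

(* For [M = bimod] this is a triple (X, R, D), with [R = acc ModR] and
   [D = acc ModD]; no relation between D and true inequality is imposed. *)
Record frame (M : Type) : Type := Frame {
  world : Type;
  acc : M -> world -> world -> Prop
}.

Fixpoint sat (M : Type) (F : frame M) (V : nat -> world F -> Prop)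
    (x : world F) (a : form M) : Prop :=
  match a with
  | Var i => V i x
  | Bot => False
  | Imp b c => sat V x b -> sat V x c
  | Dia m b => exists2 y, acc m x y & sat V y b
  end.

Definition valid (M : Type) (F : frame M) (a : form M) : Prop :=
  forall (V : nat -> world F -> Prop) (x : world F), sat V x a.

Definition validates (M : Type) (F : frame M) (L : logic M) : Prop :=
  forall a, L a -> valid F a.

Definition exponential_fmp (M : eqType) (L : logic M) : Prop :=
  forall a, ~ L a ->
    exists (X : finType) (r : M -> X -> X -> Prop),
      [/\ #|X| <= 2 ^ num_subforms a,
          validates (Frame r) L
        & exists (V : nat -> X -> Prop) (x : X), ~ @sat M (Frame r) V x a].

(** * Decidability *)

(* The total recursive functions: the least class containing the initial
   functions and closed under composition, primitive recursion, and
   minimization of functions that have a zero for all parameters. *)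
Inductive recursive : forall n : nat, (n.-tuple nat -> nat) -> Prop :=
| rec_zero n : recursive (fun _ : n.-tuple nat => 0)
| rec_succ : recursive (fun v : 1.-tuple nat => (thead v).+1)
| rec_proj n (i : 'I_n) : recursive (fun v : n.-tuple nat => tnth v i)
| rec_comp m n (f : m.-tuple nat -> nat) (g : 'I_m -> n.-tuple nat -> nat) :
    recursive f -> (forall i, recursive (g i)) ->
    recursive (fun v : n.-tuple nat => f [tuple g i v | i < m])
| rec_prim n (f : n.-tuple nat -> nat) (g : n.+2.-tuple nat -> nat)
    (h : n.+1.-tuple nat -> nat) :
    recursive f -> recursive g ->
    (forall v : n.-tuple nat, h [tuple of 0 :: v] = f v) ->
    (forall x (v : n.-tuple nat),
       h [tuple of x.+1 :: v] = g [tuple of x :: h [tuple of x :: v] :: v]) ->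
    recursive h
| rec_mu n (g : n.+1.-tuple nat -> nat) (h : n.-tuple nat -> nat) :
    recursive g ->
    (forall v : n.-tuple nat, g [tuple of h v :: v] = 0) ->
    (forall (v : n.-tuple nat) x, x < h v -> g [tuple of x :: v] != 0) ->
    recursive h.

Definition pair_code (x y : nat) : nat := (x + y) ^ 2 + x.

(* A Goedel numbering: the residue modulo 4 (and being 0) separates the constructors, and
   [pair_code] is injective because (x + y)^2 <= (x + y)^2 + x < (x + y + 1)^2. *)
Fixpoint code (a : form bimod) : nat :=
  match a with
  | Bot => 0
  | Var i => 4 * i + 1
  | Imp b c => 4 * pair_code (code b) (code c) + 2
  | Dia ModR b => 4 * code b + 3
  | Dia ModD b => 4 * code b + 4
  end.

Lemma pair_code_inj x y x' y' :
  pair_code x y = pair_code x' y' -> x = x' /\ y = y'.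
Proof.
rewrite /pair_code !expnS !expn0 !muln1 => e.
have es : x + y = x' + y' by nia.
by rewrite es in e; lia.
Qed.

Lemma code_inj : injective code.
Proof.
elim=> [i||a IHa b IHb|m a IHa] [j||c d|n c] //=;
  try (case: m => /=); try (case: n => /=); try lia.
- by move=> e; congr Var; lia.
- move=> e; have /pair_code_inj [/IHa -> /IHb -> //] :
    pair_code (code a) (code b) = pair_code (code c) (code d) by lia.
- by move=> e; rewrite (IHa c) //; lia.
- by move=> e; rewrite (IHa c) //; lia.
Qed.

(* A function into [bool] would not do here: with classical axioms one exists
   for every set of formulas. *)
Definition decidable_logic (L : logic bimod) : Prop :=
  exists2 h : 1.-tuple nat -> nat, recursive h &
    forall a, (L a -> h [tuple code a] = 1) /\ (~ L a -> h [tuple code a] = 0).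

(* Main.v *)
Require Import Defs.
From mathcomp Require Import zify.
From mathcomp Require Import all_boot.
From mathcomp Require Import boolp.

(* In the canonical model take the part generated through [D] by a maximal
   consistent set refuting [a]: there [D] together with the identity is universal and
   contains [R]. Its minimal filtration through the subformulas of [a] has at
   most [2 ^ n] points, and every subset of it is defined by a boolean combination
   of subformulas. Hence a colouring of the filtration with [k] colours is a
   substitution instance of the premise of [chi k] in the canonical model, and the
   monochromatic edge obtained there is mapped to one in the filtration. So the
   filtration is again a frame of the logic. Decidability: [a] is refutable iff it
   is refuted in such a frame with at most [2 ^ (code a).+1] points, which, with
   sets of numbers coded by binary expansions, is an arithmetical statement with
   bounded quantifiers only. *)

Set Implicit Arguments.
Unset Strict Implicit.
Unset Printing Implicit Defensive.

(** * Boolean homomorphisms on formulas *)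

(** Truth at a world and membership in a maximal consistent set are both of this kind, so the
    connectives are evaluated once for the two of them. *)
Record bool_hom (M : Type) (h : form M -> bool) : Prop := {
  hom_bot : h Bot = false;
  hom_imp : forall a b, h (Imp a b) = (h a ==> h b)
}.

Section Homs.
Variables (M : Type) (h : form M -> bool).
Hypothesis hh : bool_hom h.

Lemma hom_neg a : h (Neg a) = ~~ h a.
Proof. by rewrite hom_imp // hom_bot // implybF. Qed.

Lemma hom_top : h Top.
Proof. by rewrite hom_neg hom_bot. Qed.

Lemma hom_or a b : h (Or a b) = h a || h b.
Proof. by rewrite hom_imp // hom_neg; case: (h a). Qed.

Lemma hom_and a b : h (And a b) = h a && h b.
Proof. by rewrite hom_neg hom_imp // hom_neg; case: (h a); case: (h b). Qed.

Lemma hom_bigor (I : finType) (P : pred I) (f : I -> form M) :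
  h (\big[@Or M/Bot]_(i | P i) f i) = [exists (i | P i), h (f i)].
Proof. by rewrite (big_morph h hom_or (hom_bot hh)) big_orE. Qed.

Lemma hom_bigand (I : finType) (P : pred I) (f : I -> form M) :
  h (\big[@And M/Top]_(i | P i) f i) = [forall (i | P i), h (f i)].
Proof. by rewrite (big_morph h hom_and hom_top) big_andE. Qed.

(** A homomorphism is determined by its values on variables and diamonds; hence tautologies are true
    under each one. *)
Lemma hom_bool_val a : bool_val h a = h a.
Proof. by elim: a => //= [|a -> b ->]; rewrite ?hom_bot ?hom_imp. Qed.

End Homs.

Lemma subst_bigor (M : Type) (s : nat -> form M) (I : finType) (P : pred I)
    (f : I -> form M) :
  subst s (\big[@Or M/Bot]_(i | P i) f i) =
  \big[@Or M/Bot]_(i | P i) subst s (f i).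
Proof. exact: (big_morph (subst s)). Qed.

Lemma subst_bigand (M : Type) (s : nat -> form M) (I : finType) (P : pred I)
    (f : I -> form M) :
  subst s (\big[@And M/Top]_(i | P i) f i) =
  \big[@And M/Top]_(i | P i) subst s (f i).
Proof. exact: (big_morph (subst s)). Qed.

(** * Satisfaction in Kripke frames and soundness of the logics *)

Lemma sat_hom (M : Type) (F : frame M) (V : nat -> world F -> Prop) x :
  bool_hom (fun a => `[< sat V x a >]).
Proof.
split=> [|a b /=]; first exact: asboolF.
exact: asbool_imply.
Qed.

Lemma sat_imp (M : Type) (F : frame M) (V : nat -> world F -> Prop) x a b :
  sat V x (Imp a b) <-> (sat V x a -> sat V x b).
Proof. by []. Qed.

Lemma sat_dia (M : Type) (F : frame M) (V : nat -> world F -> Prop) x m a :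
  sat V x (Dia m a) <-> exists2 y, acc m x y & sat V y a.
Proof. by []. Qed.

Lemma sat_or (M : Type) (F : frame M) (V : nat -> world F -> Prop) x a b :
  sat V x (Or a b) <-> sat V x a \/ sat V x b.
Proof.
have := hom_or (sat_hom V x) a b; rewrite -asbool_or => e.
by split=> /asboolP; [rewrite e|rewrite -e] => /asboolP.
Qed.

Lemma sat_and (M : Type) (F : frame M) (V : nat -> world F -> Prop) x a b :
  sat V x (And a b) <-> sat V x a /\ sat V x b.
Proof.
have := hom_and (sat_hom V x) a b; rewrite -asbool_and => e.
by split=> /asboolP; [rewrite e|rewrite -e] => /asboolP.
Qed.

Lemma sat_box (M : Type) (F : frame M) (V : nat -> world F -> Prop) x m a :
  sat V x (Box m a) <-> forall y, acc m x y -> sat V y a.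
Proof.
split=> [Ba y xy|Ba [y xy]]; last by apply; apply: Ba.
by apply: contrapT => na; apply: Ba; exists y.
Qed.

Lemma sat_bigor (M : Type) (F : frame M) (V : nat -> world F -> Prop) x
    (I : finType) (f : I -> form M) :
  sat V x (\big[@Or M/Bot]_i f i) <-> exists i, sat V x (f i).
Proof.
have e := hom_bigor (sat_hom V x) predT f.
split=> [/asboolP|[i fi]]; first by rewrite e => /existsP[i /asboolP]; exists i.
by apply/asboolP; rewrite e; apply/existsP; exists i; apply/asboolP.
Qed.

Lemma sat_subst (M : Type) (F : frame M) (V : nat -> world F -> Prop) s a x :
  sat V x (subst s a) <-> sat (fun i y => sat V y (s i)) x a.
Proof.
elim: a x => //= [a IHa b IHb|m a IHa] x; first by rewrite IHa IHb.
by split=> -[y xy /IHa]; exists y.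
Qed.

Lemma valid_normal (M : Type) (F : frame M) : normal (@valid M F).
Proof.
split=> [a Ta|m|m|a b Lab La|s a La|m a b Lab] V x.
- apply/asboolP; rewrite -(hom_bool_val (sat_hom V x)); exact: Ta.
- by case.
- apply/sat_imp => /sat_dia[y xy /sat_or[]] ?; apply/sat_or; [left|right]; by exists y.
- exact: (Lab V x (La V x)).
- by apply/sat_subst.
- by move=> [y xy ya]; exists y => //; apply: (Lab V y ya).
Qed.

(** A translated formula only sees the relations indexed through [f], so it is evaluated in the
    corresponding reduct of the frame. *)
Lemma sat_map_mod (M N : Type) (f : M -> N) (F : frame N)
    (V : nat -> world F -> Prop) a x :
  sat V x (map_mod f a) <-> @sat M (Frame (fun m => @acc N F (f m))) V x a.
Proof.
elim: a x => //= [a IHa b IHb|m a IHa] x; first by rewrite IHa IHb.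
by split=> -[y xy /IHa]; exists y.
Qed.

(* The frames [(X, R, D)] generated by a point: there [D] together with the identity
   is the universal relation. *)
Record good (sym : bool) (k : nat) (X : Type) (r : bimod -> X -> X -> Prop) :
    Prop := {
  good_Dsym : forall x y, r ModD x y -> r ModD y x;
  good_Dtotal : forall x y, x <> y -> r ModD x y;
  good_Rsym : sym -> forall x y, r ModR x y -> r ModR y x;
  good_col : forall c : X -> 'I_k, exists x y, r ModR x y /\ c x = c y
}.

(** The flag [sym] lets one argument serve both logics; symmetry of [R] is the only difference
    between their frames. *)
Definition base_logic (sym : bool) : logic unimod :=
  if sym then logicKB else logicK.

Definition chi_logic (sym : bool) (k : nat) : logic bimod :=
  plus (neq_logic (base_logic sym)) (eq (chi k)).

Lemma logicK_sub L : normal L -> forall a, logicK a -> L a.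
Proof. by move=> nL a; apply. Qed.

Lemma base_logic_valid (sym : bool) (X : Type) (r : unimod -> X -> X -> Prop) :
  (sym -> forall x y, r tt x y -> r tt y x) ->
  validates (Frame r) (base_logic sym).
Proof.
move=> rsym a; have nF := valid_normal (Frame r).
case: sym rsym => [/(_ isT) rsym|_]; last exact: logicK_sub.
apply=> // _ [/(logicK_sub nF)//|<-] V x; apply/sat_imp => px; apply/sat_box => y xy.
by exists x => //; apply: rsym.
Qed.

Lemma sat_Ex (X : Type) (r : bimod -> X -> X -> Prop) V x a :
  @sat bimod (Frame r) V x (Ex a) <->
  exists2 y, r ModD x y \/ x = y & @sat bimod (Frame r) V y a.
Proof.
split=> [/sat_or[[y xy ya]|xa]|[y [xy|<-] ya]].
- by exists y => //; left.
- by exists x => //; right.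
- by apply/sat_or; left; exists y.
- by apply/sat_or; right.
Qed.

(** As [D] with the identity is universal, the premise gives every point a colour; a monochromatic
    edge under a choice of such colours witnesses the conclusion. *)
Lemma chi_valid (sym : bool) k X (r : bimod -> X -> X -> Prop) :
  good sym k r -> valid (Frame r) (chi k).
Proof.
move=> gr V x; rewrite /chi; apply/sat_imp => /sat_and[/sat_box Ax Axx].
have U y : r ModD x y \/ x = y.
  by case: (pselect (x = y)) => [|/(good_Dtotal gr)]; [right|left].
have /choice[c cP] : forall y, exists i : 'I_k, V i y.
  move=> y; suff: sat V y (\big[@Or bimod/Bot]_(i < k) And (Var i)
      (\big[@And bimod/Top]_(j < k | i != j) Neg (Var j))).
    by move=> /sat_bigor[i /sat_and[Vi _]]; exists i.
  by case: (U y) => [/Ax//|<-].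
have [y [z [yz cyz]]] := good_col gr c.
apply/sat_Ex; exists y => //; apply/sat_bigor; exists (c y); apply/sat_and; split.
  exact: cP.
by exists z => //; rewrite cyz; apply: cP.
Qed.

Lemma good_validates sym k X (r : bimod -> X -> X -> Prop) :
  good sym k r -> validates (Frame r) (chi_logic sym k).
Proof.
move=> gr a; have nF := valid_normal (Frame r).
(* Membership in [chi_logic] quantifies over normal logics; instantiated at the logic of the frame,
   it leaves only the axioms to check. *)
apply=> // b [Lb|<-]; last exact: chi_valid gr.
apply: (Lb _ nF) => c [[d Ld ->]|ax].
  move=> V x; apply/sat_map_mod; move: V x.
  by apply: (base_logic_valid _ Ld); apply: good_Rsym gr.
have U x y : r ModD x y \/ x = y.
  by case: (pselect (x = y)) => [|/(good_Dtotal gr)]; [right|left].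
case: ax => -> V x.
- by apply/sat_imp => px; apply/sat_box => y xy; exists x => //; apply: (good_Dsym gr).
- by apply/sat_imp => /sat_dia[y _ [z _ pz]]; apply/sat_Ex; exists z.
- by apply/sat_imp => /sat_dia[y _ py]; apply/sat_Ex; exists y.
Qed.

(** * Subformulas and the enumeration of formulas *)

Lemma mem_subforms_refl (a : form bimod) : a \in subforms a.
Proof. by case: a => *; rewrite inE eqxx. Qed.

Lemma subforms_imp (c a b : form bimod) : Imp a b \in subforms c ->
  (a \in subforms c) && (b \in subforms c).
Proof.
elim: c => [i||c IHc d IHd|m c IHc] /=; rewrite !in_cons ?mem_cat.
- by rewrite orbF => /eqP.
- by rewrite orbF => /eqP.
- case/or3P => [/eqP[-> ->]|/IHc/andP[-> ->]|/IHd/andP[-> ->]];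
  by rewrite ?mem_subforms_refl !orbT.
- by case/orP => [/eqP//|/IHc/andP[-> ->]]; rewrite !orbT.
Qed.

Lemma subforms_dia (c a : form bimod) m : Dia m a \in subforms c ->
  a \in subforms c.
Proof.
elim: c => [i||c IHc d IHd|m' c IHc] /=; rewrite !in_cons ?mem_cat.
- by rewrite orbF => /eqP.
- by rewrite orbF => /eqP.
- by case/or3P => [/eqP//|/IHc|/IHd] ->; rewrite !orbT.
- by case/orP => [/eqP[_ ->]|/IHc ->]; rewrite ?mem_subforms_refl !orbT.
Qed.

(** A classical inverse of [code] that enumerates all formulas for the Lindenbaum construction;
    numbers that code nothing are sent to [Bot]. *)
Definition decode (n : nat) : form bimod :=
  if pselect (exists a, code a = n) is left e then projT1 (cid e) else Bot.

Lemma codeK : cancel code decode.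
Proof.
move=> a; rewrite /decode; case: pselect => [e|[]]; last by exists a.
by apply: code_inj; case: cid.
Qed.

(** * The canonical model and its filtration *)

Section Canonical.
Variable L : logic bimod.
Hypothesis nL : normal L.

Definition theory (T : logic bimod) : Prop :=
  (forall a, L a -> T a) /\ (forall a b, T (Imp a b) -> T a -> T b).

(** A maximal consistent set, given by its characteristic function: commuting with [Bot] and [Imp]
    expresses consistency and maximality at once. *)
Record mcs (h : form bimod -> bool) : Prop := {
  mcs_hom : bool_hom h;
  mcs_sub : forall a, L a -> h a
}.

Section Lindenbaum.
Variables (T : logic bimod) (a : form bimod).
Hypotheses (thT : theory T) (nTa : ~ T a).

Lemma theory_taut (U : logic bimod) b : theory U -> tautology b -> U b.
Proof. by move=> [LU _] /(normal_taut nL)/LU. Qed.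

(** By the deduction theorem this is the theory generated by [U] and [b]. *)
Lemma theory_imp (U : logic bimod) b :
  theory U -> theory (fun c => U (Imp b c)).
Proof.
move=> thU; have [LU mpU] := thU; split=> [c /LU Uc|c d Ubcd Ubc].
  apply: mpU Uc; apply: theory_taut => // v /=.
  by case: bool_val; case: bool_val.
apply: (mpU _ _ _ Ubc); apply: (mpU _ _ _ Ubcd); apply: theory_taut => // v /=.
by do 3!case: bool_val.
Qed.

(** Stage [n] adds the formula with code [n] unless [a] would become derivable. Avoiding [a], rather
    than [Bot], keeps [a] out of the limit. *)
Fixpoint lind (n : nat) : logic bimod :=
  if n is n'.+1 then
    if `[< lind n' (Imp (decode n') a) >] then lind n'
    else fun b => lind n' (Imp (decode n') b)
  else T.

Lemma lind_theory n : theory (lind n).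
Proof.
by elim: n => //= n IHn; case: ifP => // _; apply: theory_imp.
Qed.

Lemma lind_mono m n b : m <= n -> lind m b -> lind n b.
Proof.
move=> /subnKC <-; elim: (n - m) => [|d IHd]; first by rewrite addn0.
rewrite addnS /= => /IHd {}IHd; case: ifP => // _.
have th := lind_theory (m + d); apply: (th.2 _ _ _ IHd).
by apply: theory_taut => // v /=; do 2!case: bool_val.
Qed.

Lemma lind_avoids n : ~ lind n a.
Proof. by elim: n => //= n IHn; case: ifPn => // /asboolP. Qed.

Definition lind_lim (b : form bimod) : bool := `[< exists n, lind n b >].

Lemma lind_limP b : reflect (exists n, lind n b) (lind_lim b).
Proof. exact: asboolP. Qed.

Lemma lind_lim_theory : theory lind_lim.
Proof.
split=> [b Lb|b c /lind_limP[m mbc] /lind_limP[n nb]]; apply/lind_limP.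
  by exists 0; apply: thT.1.
exists (maxn m n); have th := lind_theory (maxn m n).
by apply: th.2; [apply: lind_mono mbc|apply: lind_mono nb];
  rewrite ?leq_maxl ?leq_maxr.
Qed.

Lemma lind_lim_dec b : lind_lim b || lind_lim (Imp b a).
Proof.
case: (pselect (lind (code b) (Imp b a))) => [l|nl]; apply/orP; [right|left].
  by apply/lind_limP; exists (code b).
(* Stage [code b] is the one that decides [b]; once [b] is added, its membership amounts to the
   tautology [Imp b b]. *)
apply/lind_limP; exists (code b).+1 => /=; rewrite codeK asboolF //.
by apply: theory_taut => [|v /=]; [apply: lind_theory|case: bool_val].
Qed.

Lemma lind_lim_avoids : lind_lim a = false.
Proof. by apply/lind_limP => -[n]; apply: lind_avoids. Qed.

Lemma lind_lim_mcs : mcs lind_lim.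
Proof.
have th := lind_lim_theory; have mp := th.2; have na := lind_lim_avoids.
have taut b : tautology b -> lind_lim b by move=> tb; apply: (theory_taut th).
split=> [|b]; last exact: th.1.
split=> [|b c].
  by apply: contraFF na => hb; apply: mp hb; apply: taut.
apply/idP/implyP => [|bc]; first exact: mp.
(* One of [b] and [Imp b c] is always true, so having both [Imp b a] and [Imp (Imp b c) a] in the
   limit would force [a] into it. *)
apply: contraFT na => /negbTE nbc.
have := lind_lim_dec (Imp b c); rewrite nbc /= => bca.
have ba : lind_lim (Imp b a).
  have := lind_lim_dec b; case: (boolP (lind_lim b)) => //= /bc c1 _.
  suff: lind_lim (Imp b c) by rewrite nbc.
  by apply: mp c1; apply: taut => v /=; do 2!case: bool_val.
apply: (mp _ _ _ ba); apply: (mp _ _ _ bca); apply: taut => v /=.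
by do 3!case: bool_val.
Qed.

Lemma lindenbaum :
  exists h, [/\ mcs h, (forall b, T b -> h b) & h a = false].
Proof.
exists lind_lim; split=> [|b Tb|]; [exact: lind_lim_mcs| |exact: lind_lim_avoids].
by apply/lind_limP; exists 0.
Qed.

End Lindenbaum.

(** Replaces derivations in [L]: a formula is shown to be in [L] by computing its value in all
    maximal consistent sets. *)
Lemma mcs_complete a : (forall h, mcs h -> h a) -> L a.
Proof.
move=> all_a; apply: contrapT => nLa.
have thL : theory L by split=> // b c; apply: (normal_mp nL).
by have [h [/all_a -> _]] := lindenbaum thL nLa.
Qed.

Lemma mcs_mono g m a b : mcs g -> (forall h, mcs h -> h a -> h b) ->
  g (Dia m a) -> g (Dia m b).
Proof.
move=> mg ab; have : L (Imp a b).
  apply: mcs_complete => h mh.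
  by rewrite (hom_imp (mcs_hom mh)); apply/implyP/ab.
move=> /(normal_mono nL m) /(mcs_sub mg).
by rewrite (hom_imp (mcs_hom mg)) => /implyP.
Qed.

Lemma mcs_dia_bot g m : mcs g -> g (Dia m Bot) = false.
Proof.
move=> mg; have := mcs_sub mg (normal_bot nL m).
by rewrite (hom_neg (mcs_hom mg)) => /negbTE.
Qed.

Lemma mcs_dia_or g m a b : mcs g -> g (Dia m (Or a b)) ->
  g (Dia m a) || g (Dia m b).
Proof.
move=> mg; have hg := mcs_hom mg.
have := mcs_sub mg (normal_subst nL (fun i => if i is 0 then a else b)
  (normal_or nL m)).
rewrite (hom_imp hg) => /implyP/= i /i.
by rewrite -(hom_or hg).
Qed.

(** * Canonical relations and the axioms they satisfy *)

Definition can_acc (m : bimod) (g h : form bimod -> bool) : Prop :=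
  forall a, h a -> g (Dia m a).

(** The existence lemma: the formulas [c] for which [g] contains the box of [Imp a c] form a
    consistent theory, and any maximal consistent extension of it is a successor containing [a]. *)
Lemma can_exists g m a : mcs g -> g (Dia m a) ->
  exists h, [/\ mcs h, can_acc m g h & h a].
Proof.
move=> mg ga.
pose T c := ~~ g (Dia m (And a (Neg c))).
have thT : theory T.
  split=> [c Lc|c d Tcd Tc]; first rewrite /T.
    apply: contraFN (mcs_dia_bot m mg); apply: mcs_mono => // h mh.
    have hh := mcs_hom mh.
    by rewrite (hom_and hh) (hom_neg hh) (mcs_sub mh Lc) andbF.
  apply/negP => Td.
  suff: g (Dia m (Or (And a (Neg (Imp c d))) (And a (Neg c)))).
    by move/(mcs_dia_or mg); rewrite (negbTE Tcd) (negbTE Tc).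
  apply: mcs_mono Td => // h mh; have hh := mcs_hom mh.
  rewrite !(hom_or hh, hom_and hh, hom_neg hh, hom_imp hh).
  by case: (h a); case: (h c); case: (h d).
have nT : ~ T Bot.
  move=> /negP; apply; apply: mcs_mono ga => // h mh; have hh := mcs_hom mh.
  by rewrite (hom_and hh) (hom_neg hh) (hom_bot hh) andbT.
have [h [mh Th _]] := lindenbaum thT nT; have hh := mcs_hom mh.
(* What [g] denies to be possible is refuted in the theory; the contrapositive is the canonical
   relation. *)
have Tneg c : g (Dia m c) = false -> T (Neg c).
  move=> nc; apply: contraFN nc; apply: mcs_mono => // f mf.
  have hf := mcs_hom mf.
  by rewrite (hom_and hf) !(hom_neg hf) negbK => /andP[].
exists h; split=> // [c hc|].
  apply: contraTT hc => /negbTE /Tneg /Th; by rewrite (hom_neg hh).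
apply: Th; apply: contraFN (mcs_dia_bot m mg); apply: mcs_mono => // f mf.
have hf := mcs_hom mf.
by rewrite (hom_and hf) (hom_neg hf) andbN.
Qed.

(** Canonicity of the axiom B. It serves for [ModD] in both logics and for [ModR] in the symmetric
    one. *)
Lemma can_sym m : L (Imp (Var 0) (Box m (Dia m (Var 0)))) ->
  forall g h, mcs g -> mcs h -> can_acc m g h -> can_acc m h g.
Proof.
move=> Lax g h mg mh gh a ga; have hg := mcs_hom mg; have hh := mcs_hom mh.
have := mcs_sub mg (normal_subst nL (fun=> a) Lax).
rewrite (hom_imp hg) /= ga /= (hom_neg hg).
by apply: contraR => na; apply: gh; rewrite (hom_neg hh).
Qed.

Section Difference.
Hypothesis Lneq : forall a, neq_axiom a -> L a.

Lemma canD_sym g h : mcs g -> mcs h -> can_acc ModD g h -> can_acc ModD h g.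
Proof. by apply: can_sym; apply: Lneq; apply: Or31. Qed.

(** If some [a] in [h] is not [ModD]-possible at [g], then for each [c] in [h] the formula
    [Ex (And a c)] can hold at [g] only because [c] is in [g]. So [h] is contained in [g], and
    maximality makes them equal. *)
Lemma can_Ex g h : mcs g -> mcs h -> (forall a, h a -> g (Ex a)) ->
  can_acc ModD g h \/ h = g.
Proof.
move=> mg mh hg; have Hg := mcs_hom mg; have Hh := mcs_hom mh.
apply: contrapT => /not_orP[/existsNP[a /not_implyP[ha /negP nga]] neq].
apply: neq; apply: funext => b.
have ab c : h c -> g c.
  move=> hc; apply: contraNT nga => ngc.
  have : g (Ex (And a c)) by apply: hg; rewrite (hom_and Hh) ha.
  rewrite (hom_or Hg) (hom_and Hg) (negbTE ngc) andbF orbF.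
  by apply: mcs_mono => // f mf; rewrite (hom_and (mcs_hom mf)) => /andP[].
apply/idP/idP; first exact: ab.
apply: contraTT => nb; have := ab (Neg b).
by rewrite (hom_neg Hh) (hom_neg Hg); apply.
Qed.

Lemma canD_trans f g h : mcs f -> mcs g -> mcs h ->
  can_acc ModD f g -> can_acc ModD g h -> can_acc ModD f h \/ h = f.
Proof.
move=> mf mg mh fg gh; apply: can_Ex => // a /gh/fg fa.
have := mcs_sub mf (normal_subst nL (fun=> a) (Lneq (Or32 _ _ erefl))).
by rewrite (hom_imp (mcs_hom mf)) /= fa.
Qed.

Lemma canR_D f g : mcs f -> mcs g ->
  can_acc ModR f g -> can_acc ModD f g \/ g = f.
Proof.
move=> mf mg fg; apply: can_Ex => // a /fg fa.
have := mcs_sub mf (normal_subst nL (fun=> a) (Lneq (Or33 _ _ erefl))).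
by rewrite (hom_imp (mcs_hom mf)) /= fa.
Qed.

Section Generated.
Variable g0 : form bimod -> bool.
Hypothesis mg0 : mcs g0.

(** The part generated by [g0]: at most one [ModD] step is enough, because [D] is transitive up to
    identity and contains [R] up to identity. *)
Definition gen (h : form bimod -> bool) : Prop :=
  mcs h /\ (can_acc ModD g0 h \/ h = g0).

Lemma gen_root : gen g0.
Proof. by split; last right. Qed.

Lemma gen_closed m g h : gen g -> mcs h -> can_acc m g h -> gen h.
Proof.
move=> [mg g0g] mh gh; split=> //.
have {gh} [gh|-> //] : can_acc ModD g h \/ h = g.
  by case: m gh => [/canR_D|]; [apply|left].
by case: g0g gh => [g0g /(canD_trans mg0 mg mh g0g)|->]; [|left].
Qed.

(** Any two points are linked through [g0], by symmetry and transitivity up to identity. *)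
Lemma gen_total g h : gen g -> gen h -> g <> h -> can_acc ModD g h.
Proof.
move=> [mg [g0g|->]] [mh [g0h|->]] // neq; last exact: canD_sym.
by have [//|/esym] := canD_trans mg mg0 mh (canD_sym mg0 mg g0g) g0h.
Qed.

Lemma gen_exists g m a : gen g -> g (Dia m a) ->
  exists h, [/\ gen h, can_acc m g h & h a].
Proof.
move=> Gg /(can_exists Gg.1)[h [mh gh ha]].
by exists h; split=> //; apply: gen_closed gh.
Qed.

(** With [gen_Ex], lets [All] and [Ex] at [g0] be read as quantifiers over the generated part. *)
Lemma gen_All a : (forall h, gen h -> h a) -> g0 (All a).
Proof.
move=> alla; have hg := mcs_hom mg0.
rewrite (hom_and hg) (hom_neg hg) alla ?andbT; last exact: gen_root.
apply/negP => /(gen_exists gen_root)[h [Gh _]].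
by rewrite (hom_neg (mcs_hom Gh.1)) alla.
Qed.

Lemma gen_Ex a : g0 (Ex a) -> exists2 h, gen h & h a.
Proof.
rewrite (hom_or (mcs_hom mg0)) => /orP[|ga]; last by exists g0 => //; apply: gen_root.
by move=> /(gen_exists gen_root)[h []]; exists h.
Qed.

(** * Filtration through the subformulas *)

Section Filtration.
Variable a0 : form bimod.
Let S := undup (subforms a0).
Let n := size S.

Definition pattern (h : form bimod -> bool) : {ffun 'I_n -> bool} :=
  [ffun i : 'I_n => h (nth Bot S i)].

Lemma patternP g h a : pattern g = pattern h -> a \in S -> g a = h a.
Proof.
move=> /ffunP e Sa; have ia : index a S < n by rewrite index_mem.
by have := e (Ordinal ia); rewrite !ffunE /= nth_index.
Qed.

(** Each pattern has a characteristic conjunction of subformulas and their negations; the defining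
    formula is the disjunction of these over the finitely many patterns in [p]. *)
Lemma pattern_definable (p : pred {ffun 'I_n -> bool}) :
  exists b, forall h, mcs h -> h b = p (pattern h).
Proof.
exists (\big[@Or bimod/Bot]_(s | p s) \big[@And bimod/Top]_(i < n)
  if s i then nth Bot S i else Neg (nth Bot S i)) => h mh.
have hh := mcs_hom mh; rewrite (hom_bigor hh).
have charE (s : {ffun 'I_n -> bool}) :
    h (\big[@And bimod/Top]_(i < n)
      if s i then nth Bot S i else Neg (nth Bot S i)) = (pattern h == s).
  rewrite (hom_bigand hh); apply/forallP/eqP => [all_i|<- i].
    apply/ffunP => i; rewrite ffunE; have /= := all_i i.
    by case: (s i); rewrite ?(hom_neg hh); case: (h _).
  by rewrite ffunE /=; case: ifPn => //; rewrite (hom_neg hh).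
apply/existsP/idP => [[s]|ph]; first by rewrite charE => /andP[ps /eqP->].
by exists (pattern h); rewrite charE ph eqxx.
Qed.

(** Realised patterns stand for the classes of the filtration, so finiteness and the bound [2 ^ n]
    are immediate. *)
Definition filt : finType :=
  {s : {ffun 'I_n -> bool} | `[< exists2 h, gen h & pattern h = s >]}.

(** The image of the canonical relation under [pattern]: each edge lifts to a canonical one, which
    makes symmetry descend. *)
Definition filt_acc (m : bimod) (s t : filt) : Prop :=
  exists g h, [/\ gen g, gen h, can_acc m g h, pattern g = val s
    & pattern h = val t].

Definition filt_val (i : nat) (s : filt) : Prop :=
  exists h, [/\ gen h, pattern h = val s & h (Var i)].

Lemma filt_ex h : gen h -> exists s : filt, val s = pattern h.
Proof.
move=> Gh; have ph : `[< exists2 g, gen g & pattern g = pattern h >].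
  by apply/asboolP; exists h.
by exists (exist _ (pattern h) ph).
Qed.

Lemma filt_repr (s : filt) : exists2 h, gen h & pattern h = val s.
Proof. by case: s => s /= /asboolP. Qed.

Lemma card_filt : #|filt| <= 2 ^ num_subforms a0.
Proof.
rewrite card_sig; apply: leq_trans (max_card _) _.
by rewrite card_ffun card_bool card_ord.
Qed.

Lemma filt_truth a (s : filt) h : a \in S -> gen h -> pattern h = val s ->
  @sat bimod (Frame filt_acc) filt_val s a <-> h a.
Proof.
elim: a s h => [i||a IHa b IHb|m a IHa] s h Sa Gh hs /=.
- split=> [[g [Gg gs gi]]|hi]; last by exists h.
  by rewrite (@patternP h g) ?hs.
- by rewrite (hom_bot (mcs_hom Gh.1)).
- rewrite (hom_imp (mcs_hom Gh.1)).
  move: Sa; rewrite !mem_undup => /subforms_imp/andP[Sa Sb].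
  have {}IHa := IHa s h; have {}IHb := IHb s h.
  rewrite IHa ?mem_undup // IHb ?mem_undup //.
  by split=> [/implyP|/implyP].
- have S'a : a \in S by move: Sa; rewrite !mem_undup => /subforms_dia.
  split=> [[t [g [g' [Gg Gg' gg' gs gt]]] /(IHa t g' S'a Gg' gt) g'a]|].
    (* The lifted edge starts at some [g] that may differ from [h]; having the same pattern, they
       agree on [Dia m a]. *)
    by rewrite (@patternP h g) ?hs //; apply: gg'.
  move=> /(gen_exists Gh)[g [Gg hg ga]]; have [t tg] := filt_ex Gg.
  by exists t; [exists h, g|apply/(IHa t g)].
Qed.

Lemma filt_good (sym : bool) k :
  (sym -> L (map_mod (fun=> ModR) axB)) -> L (chi k) ->
  good sym k filt_acc.
Proof.
move=> Lsym Lchi; split.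
- move=> s t [g [h [Gg Gh gh gs ht]]]; exists h, g; split=> //.
  by apply: canD_sym => //; [case: Gg|case: Gh].
- move=> s t st; have [g Gg gs] := filt_repr s; have [h Gh ht] := filt_repr t.
  exists g, h; split=> //; apply: gen_total => // gh.
  by apply: st; apply: val_inj; rewrite -gs -ht gh.
- move=> /Lsym Lax s t [g [h [Gg Gh gh gs ht]]]; exists h, g; split=> //.
  by apply: can_sym gh => //; [case: Gg|case: Gh].
move=> c.
(* The colour class [i] as a set of patterns; unrealised patterns are in no class. *)
pose p (i : 'I_k) (s : {ffun 'I_n -> bool}) :=
  [exists t : filt, (val t == s) && (c t == i)].
have pE i (t : filt) : p i (val t) = (c t == i).
  apply/existsP/idP => [[t' /andP[/eqP/val_inj -> //]]|ct].
  by exists t; rewrite eqxx.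
have /choice[f fP] : forall i, exists b, forall h, mcs h -> h b = p i (pattern h).
  by move=> i; apply: pattern_definable.
have fE i h t : gen h -> val t = pattern h -> h (f i) = (c t == i).
  by move=> Gh th; rewrite fP -?th ?pE //; case: Gh.
(* Variable [i < k] becomes the formula defining colour [i]; the other variables, which do not occur
   in [chi k], become [Bot]. *)
pose s i := if insub i is Some j then f j else Bot.
have sE (i : 'I_k) : s i = f i by rewrite /s valK.
have := mcs_sub mg0 (normal_subst nL s Lchi).
rewrite /chi /= -/(Neg _) -/(And _ _) !subst_bigor.
set A := \big[_/_]_(i < k) _; set E := \big[_/_]_(i < k) _.
(* The instance of [chi k] is folded back into [All] and [Ex]. Two goals follow: the conclusion
   yields a monochromatic edge, and the premise holds as each point has exactly one colour. *)
rewrite -[X in is_true X]/(g0 (Imp (All A) (Ex E))) (hom_imp (mcs_hom mg0)).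
rewrite gen_All /= => [/gen_Ex[h Gh]|h Gh]; have hh := mcs_hom Gh.1.
  rewrite /E (hom_bigor hh) => /existsP[i /=]; rewrite !sE.
  have [t th] := filt_ex Gh.
  rewrite -[X in is_true X]/(h (And (f i) (Dia ModR (f i)))) (hom_and hh).
  rewrite (fE _ _ _ Gh th) => /andP[/eqP ti /(gen_exists Gh)[h' [Gh' hh' fi]]].
  have [t' th'] := filt_ex Gh'; move: fi; rewrite (fE _ _ _ Gh' th') => /eqP ti'.
  by exists t, t'; split; [exists h, h'|rewrite ti ti'].
have [t th] := filt_ex Gh.
rewrite /A (hom_bigor hh); apply/existsP; exists (c t).
rewrite -[X in is_true X]/(h (And (s (c t)) (subst s
  (\big[@And bimod/Top]_(j < k | c t != j) Neg (Var j))))).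
rewrite (hom_and hh) sE (fE _ _ _ Gh th) eqxx /= subst_bigand (hom_bigand hh).
apply/forallP => j; apply/implyP => ne.
by rewrite -[X in is_true X]/(h (Neg (s j))) (hom_neg hh) sE (fE _ _ _ Gh th).
Qed.

End Filtration.
End Generated.
End Difference.
End Canonical.

(** The frame is provided as [good] and not merely as validating the logic, since [good] is what a
    bounded search can test. *)
Lemma chi_logic_fmp (sym : bool) k a : ~ chi_logic sym k a ->
  exists (X : finType) (r : bimod -> X -> X -> Prop),
    [/\ #|X| <= 2 ^ num_subforms a, good sym k r
      & exists (V : nat -> X -> Prop) (x : X), ~ @sat bimod (Frame r) V x a].
Proof.
move=> nLa.
have nL : normal (chi_logic sym k) by apply: least_normal_normal.
have Lneq b : neq_axiom b -> chi_logic sym k b.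
  by move=> ax L nL' sub; apply: sub; left => L' nL'' sub'; apply: sub'; right.
have thL : theory (chi_logic sym k) (chi_logic sym k).
  by split=> // b c; apply: (normal_mp nL).
have [g0 [mg0 _ g0a]] := lindenbaum nL thL nLa.
exists (filt (chi_logic sym k) g0 a), (@filt_acc (chi_logic sym k) g0 a).
split; first exact: card_filt.
  apply: filt_good => // [symT|].
    move=> L nL' sub; apply: sub; left => L' nL'' sub'; apply: sub'; left.
    exists axB => //; rewrite /base_logic symT => L1 nL1; apply; by right.
  by move=> L nL' sub; apply: sub; right.
exists (@filt_val (chi_logic sym k) g0 a).
have G0 := gen_root mg0; have [s sg] := filt_ex a G0; exists s.
have Sa : a \in undup (subforms a) by rewrite mem_undup mem_subforms_refl.
by move=> /(filt_truth nL Lneq mg0 Sa G0 (esym sg)); rewrite g0a.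
Qed.

(** * Recursive functions *)

Lemma eq_recursive n (f g : n.-tuple nat -> nat) :
  f =1 g -> recursive f -> recursive g.
Proof. by move=> /funext ->. Qed.

(** A change of arguments that preserves recursiveness; it allows functions to be written with
    ordinary variables instead of explicit compositions of projections. *)
Definition rmap m n (T : m.-tuple nat -> n.-tuple nat) : Prop :=
  forall f, recursive f -> recursive (f \o T).

Lemma rmap_tnth m n (T : m.-tuple nat -> n.-tuple nat) :
  (forall i, recursive (fun v => tnth (T v) i)) -> rmap T.
Proof.
move=> rT f rf; apply: eq_recursive (rec_comp rf rT) => v /=; congr f.
by apply: eq_from_tnth => i; rewrite tnth_mktuple.
Qed.

Lemma rmap_id n : rmap (fun v : n.-tuple nat => v).
Proof. by []. Qed.

Lemma rmap_behead m n (T : m.-tuple nat -> n.+1.-tuple nat) :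
  rmap T -> rmap (fun v => behead_tuple (T v)).
Proof.
move=> rT f rf; apply: (rT (f \o @behead_tuple _ _)); apply: (rmap_tnth _ rf) => i.
apply: eq_recursive (rec_proj (lift ord0 i)) => v.
by rewrite [in LHS](tuple_eta v) tnthS.
Qed.

Lemma rmap_cons m n (T : m.-tuple nat -> n.-tuple nat) b :
  rmap T -> recursive b -> rmap (fun v => [tuple of b v :: T v]).
Proof.
move=> rT rb; apply: rmap_tnth => i; case: (unliftP ord0 i) => [j|] ->.
  by apply: eq_recursive (rT _ (rec_proj j)) => v; rewrite tnthS.
by apply: eq_recursive rb => v; rewrite tnth0.
Qed.

Lemma rec_thead m n (T : m.-tuple nat -> n.+1.-tuple nat) :
  rmap T -> recursive (fun v => thead (T v)).
Proof. by move=> rT; apply: (rT _ (rec_proj ord0)). Qed.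

Lemma rec_S n (f : n.-tuple nat -> nat) :
  recursive f -> recursive (fun v => (f v).+1).
Proof.
move=> rf; have rT : rmap (fun v => [tuple f v]).
  by apply: rmap_tnth => i; apply: eq_recursive rf => v; rewrite (ord1 i) tnth0.
by apply: eq_recursive (rT _ rec_succ) => v /=; rewrite theadE.
Qed.

Lemma rec_const n c : recursive (fun _ : n.-tuple nat => c).
Proof. by elim: c => [|c]; [exact: rec_zero|exact: rec_S]. Qed.

(** Primitive recursion with [v] as parameters. In the argument tuple of [step] the counter comes
    first, then the previous value, then [v]. *)
Lemma rec_nat_rect n (b f : n.-tuple nat -> nat) step :
  recursive b -> recursive f ->
  recursive (fun w : n.+2.-tuple nat => step (thead w) (thead (behead_tuple w))
    (behead_tuple (behead_tuple w))) ->
  recursive (fun v => nat_rect (fun=> nat) (f v) (fun x y => step x y v) (b v)).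
Proof.
move=> rb rf rs.
pose h (w : n.+1.-tuple nat) := nat_rect (fun=> nat) (f (behead_tuple w))
  (fun x y => step x y (behead_tuple w)) (thead w).
have bK m x (v : m.-tuple nat) : behead_tuple [tuple of x :: v] = v.
  by apply: val_inj.
have rh : recursive h.
  apply: rec_prim rf rs _ _ => [v|x v]; rewrite /h /= ?theadE ?bK //.
by apply: eq_recursive (rmap_cons (@rmap_id n) rb rh) => v /=; rewrite /h theadE bK.
Qed.

Lemma rec_app m n (T : m.-tuple nat -> n.-tuple nat) (f : n.-tuple nat -> nat) :
  recursive f -> rmap T -> recursive (fun v => f (T v)).
Proof. by move=> rf; apply. Qed.

Lemma rec_add n (f g : n.-tuple nat -> nat) :
  recursive f -> recursive g -> recursive (fun v => f v + g v).
Proof.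
move=> rf rg.
apply: eq_recursive (rec_nat_rect (step := fun _ y _ => y.+1) rf rg _) => [v|].
  by elim: (f v) => //= m ->.
by apply: rec_S; apply: rec_thead; apply: rmap_behead; apply: rmap_id.
Qed.

(** Bound variables behave like de Bruijn indices: each recursion or bounded quantifier pushes onto
    the tuple, so an outer variable is reached through iterated tails. *)
Ltac rec_var :=
  first [exact: rmap_id | apply: rmap_behead; rec_var].

Ltac rec_base :=
  match goal with
  | |- recursive (@thead _ _) => exact: (rec_proj ord0)
  | |- recursive ?f => assumption
  | |- recursive (fun w => thead (@?T w)) => apply: rec_thead; rec_var
  | |- recursive (fun w => nat_of_bool (?p (@?T w))) =>
     apply: (@rec_app _ _ T (fun v => nat_of_bool (p v))); [assumption | rec_var]
  | |- recursive (fun w => ?f (@?T w)) =>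
     apply: (@rec_app _ _ T f); [assumption | rec_var]
  | _ => exact: rec_const
  end.

Lemma rec_mul n (f g : n.-tuple nat -> nat) :
  recursive f -> recursive g -> recursive (fun v => f v * g v).
Proof.
move=> rf rg.
apply: eq_recursive
  (rec_nat_rect (step := fun _ y v => g v + y) rf (rec_const n 0) _) => [v|].
  by elim: (f v) => //= m ->.
apply: rec_add; rec_base.
Qed.

Lemma rec_exp n (f g : n.-tuple nat -> nat) :
  recursive f -> recursive g -> recursive (fun v => f v ^ g v).
Proof.
move=> rf rg.
apply: eq_recursive
  (rec_nat_rect (step := fun _ y v => f v * y) rg (rec_const n 1) _) => [v|].
  by elim: (g v) => //= m ->; rewrite expnS.
apply: rec_mul; rec_base.
Qed.

Lemma rec_pred n (f : n.-tuple nat -> nat) : recursive f -> recursive (fun v => (f v).-1).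
Proof.
move=> rf; apply: eq_recursive
  (rec_nat_rect (step := fun x _ _ => x) rf (rec_const n 0) _) => [v|].
  by case: (f v).
rec_base.
Qed.

Lemma rec_sub n (f g : n.-tuple nat -> nat) :
  recursive f -> recursive g -> recursive (fun v => f v - g v).
Proof.
move=> rf rg; apply: eq_recursive
  (rec_nat_rect (step := fun _ y _ => y.-1) rg rf _) => [v|].
  by elim: (g v) => [|m /= ->]; rewrite ?subn0 ?subnS.
apply: rec_pred; rec_base.
Qed.

(** A predicate counts as recursive when its characteristic function is, through the coercion of
    [bool] to [nat]. *)
Lemma rec_neg n (p : n.-tuple nat -> bool) :
  recursive (fun v => p v) -> recursive (fun v => ~~ p v).
Proof.
move=> rp; apply: eq_recursive (rec_sub (rec_const n 1) rp) => v.
by case: (p v).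
Qed.

Lemma rec_and n (p q : n.-tuple nat -> bool) :
  recursive (fun v => p v) -> recursive (fun v => q v) ->
  recursive (fun v => p v && q v).
Proof.
by move=> rp rq; apply: eq_recursive (rec_mul rp rq) => v; case: (p v); case: (q v).
Qed.

Lemma rec_implb n (p q : n.-tuple nat -> bool) :
  recursive (fun v => p v) -> recursive (fun v => q v) ->
  recursive (fun v => p v ==> q v).
Proof.
move=> rp rq; apply: eq_recursive (rec_neg (rec_and rp (rec_neg rq))) => v.
by case: (p v); case: (q v).
Qed.

Lemma rec_leq n (f g : n.-tuple nat -> nat) :
  recursive f -> recursive g -> recursive (fun v => f v <= g v).
Proof.
move=> rf rg; apply: eq_recursive
  (rec_sub (rec_const n 1) (rec_sub rf rg)) => v.
by rewrite /leq; case: (f v - g v).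
Qed.

Lemma rec_eqn n (f g : n.-tuple nat -> nat) :
  recursive f -> recursive g -> recursive (fun v => f v == g v).
Proof.
move=> rf rg; apply: eq_recursive (rec_and (rec_leq rf rg) (rec_leq rg rf)) => v.
by rewrite -eqn_leq.
Qed.

Lemma rec_eqb n (p q : n.-tuple nat -> bool) :
  recursive (fun v => p v) -> recursive (fun v => q v) ->
  recursive (fun v => p v == q v).
Proof.
move=> rp rq; apply: eq_recursive (rec_eqn rp rq) => v.
by case: (p v); case: (q v).
Qed.

Lemma rec_odd n (f : n.-tuple nat -> nat) : recursive f -> recursive (fun v => odd (f v)).
Proof.
move=> rf; apply: eq_recursive
  (rec_nat_rect (step := fun _ y _ => 1 - y) rf (rec_const n 0) _) => [v|].
  by elim: (f v) => //= m ->; case: odd.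
apply: rec_sub; rec_base.
Qed.

(** * Binary digits and bounded quantifiers *)

Definition bit (n i : nat) : bool := odd (iter i half n).

Definition ball (n : nat) (p : pred nat) : bool := all p (iota 0 n).
Definition bex (n : nat) (p : pred nat) : bool := ~~ ball n (fun x => ~~ p x).

Lemma rec_half n (f : n.-tuple nat -> nat) : recursive f -> recursive (fun v => (f v)./2).
Proof.
move=> rf; apply: eq_recursive
  (rec_nat_rect (step := fun x y _ => odd x + y) rf (rec_const n 0) _) => [v|].
  by elim: (f v) => //= m ->; rewrite uphalf_half.
by apply: rec_add; [apply: rec_odd|]; rec_base.
Qed.

Lemma rec_iter_half n (f g : n.-tuple nat -> nat) : recursive f -> recursive g ->
  recursive (fun v => iter (g v) half (f v)).
Proof.
move=> rf rg; apply: eq_recursive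
  (rec_nat_rect (step := fun _ y _ => y./2) rg rf _) => [v|].
  by elim: (g v) => //= m ->.
apply: rec_half; rec_base.
Qed.

(** A bounded conjunction is the product of its values 0 and 1, accumulated by recursion on the
    bound. *)
Lemma rec_ball n (b : n.-tuple nat -> nat) (p : n.-tuple nat -> nat -> bool) :
  recursive b -> recursive (fun w : n.+1.-tuple nat => p (behead_tuple w) (thead w)) ->
  recursive (fun v => ball (b v) (p v)).
Proof.
move=> rb rp; apply: eq_recursive
  (rec_nat_rect (step := fun x y v => p v x * y) rb (rec_const n 1) _) => [v|].
  rewrite /ball; elim: (b v) => [//|m IHm].
  have -> : iota 0 m.+1 = rcons (iota 0 m) m by rewrite -addn1 iotaD cats1.
  by rewrite all_rcons -[nat_rect _ _ _ _]/(p v m * nat_rect _ _ _ m) IHm mulnb.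
apply: rec_mul; last by rec_base.
(* The accumulated product, in second position, is dropped before [p] is applied. *)
have rT : rmap (fun w : n.+2.-tuple nat =>
    [tuple of thead w :: behead_tuple (behead_tuple w)]).
  by apply: rmap_cons; [rec_var|rec_base].
apply: eq_recursive (rec_app rp rT) => w.
by rewrite theadE; congr (nat_of_bool (p _ _)); apply: val_inj.
Qed.

Lemma rec_bex n (b : n.-tuple nat -> nat) (p : n.-tuple nat -> nat -> bool) :
  recursive b -> recursive (fun w : n.+1.-tuple nat => p (behead_tuple w) (thead w)) ->
  recursive (fun v => bex (b v) (p v)).
Proof.
by move=> rb rp; apply: rec_neg; apply: (rec_ball (p := fun v x => ~~ p v x)) => //;
  apply: rec_neg.
Qed.

Lemma rec_bit n (f g : n.-tuple nat -> nat) : recursive f -> recursive g ->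
  recursive (fun v => bit (f v) (g v)).
Proof. by move=> rf rg; apply: rec_odd; apply: rec_iter_half. Qed.

Lemma rec_pair n (f g : n.-tuple nat -> nat) : recursive f -> recursive g ->
  recursive (fun v => pair_code (f v) (g v)).
Proof.
move=> rf rg; apply: rec_add => //; apply: rec_exp; last exact: rec_const.
exact: rec_add.
Qed.

Lemma ballP n (p : pred nat) : reflect (forall x, x < n -> p x) (ball n p).
Proof.
apply: (iffP allP) => H x; first by move=> xn; apply: H; rewrite mem_iota.
by rewrite mem_iota; apply: H.
Qed.

Lemma bexP n (p : pred nat) : reflect (exists2 x, x < n & p x) (bex n p).
Proof.
rewrite /bex /ball -has_predC; apply: (iffP hasP) => -[x]; rewrite ?mem_iota /=.
  by move=> ?; rewrite negbK; exists x.
by move=> xn px; exists x; rewrite ?mem_iota //= negbK.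
Qed.

(** Bounds the search for a set: the lowest digit is [p 0], and the remaining digits code the
    shifted predicate. *)
Lemma bits_exist m (p : pred nat) :
  exists2 n, n < 2 ^ m & forall i, i < m -> bit n i = p i.
Proof.
elim: m p => [|m IHm] p; first by exists 0.
have [n nm nP] := IHm (p \o succn); exists (p 0 + n.*2).
  by rewrite expnS; case: (p 0) => /=; lia.
case=> [_|i im]; first by rewrite /bit /= oddD odd_double addbF oddb.
by rewrite /bit iterSr half_bit_double -/(bit n i) nP.
Qed.

(** * Refutability by bounded search *)

Definition bitrel (s x y : nat) : bool := bit s (pair_code x y).

Lemma pair_code_mono x y x' y' :
  x <= x' -> y <= y' -> pair_code x y <= pair_code x' y'.
Proof. by rewrite /pair_code => ? ?; apply: leq_add => //; rewrite leq_exp2r ?leq_add. Qed.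

Lemma leq_pair_codel x y : x <= pair_code x y.
Proof. by rewrite /pair_code leq_addl. Qed.

Lemma leq_pair_coder x y : y <= pair_code x y.
Proof. by rewrite /pair_code; nia. Qed.

(** By monotonicity [pair_code m m] is the largest code of a pair of numbers up to [m], hence the
    largest digit position in use. *)
Definition bitrel_bound (m : nat) : nat := 2 ^ (pair_code m m).+1.

Lemma bitrel_exist m (q : nat -> nat -> bool) :
  exists2 s, s < bitrel_bound m &
    forall x y, x <= m -> y <= m -> bitrel s x y = q x y.
Proof.
have [s sm sP] := bits_exist (pair_code m m).+1
  (fun i => `[< exists x y, pair_code x y = i /\ q x y >]).
exists s => // x y xm ym; rewrite /bitrel sP ?ltnS ?pair_code_mono //.
apply/asboolP/idP => [[x' [y' [/pair_code_inj[-> ->]]]] //|qxy].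
by exists x, y.
Qed.

(* Sets of numbers are coded by their binary expansions: [r] and [d] code the relations
   [R] and [D] on the set of worlds [0, ..., N-1]. *)
Definition frame_check (sym : bool) (k N m r d : nat) : bool :=
  ball N (fun x => ball N (fun y =>
    (bitrel d x y ==> bitrel d y x) &&
    ((~~ (x == y) ==> bitrel d x y) &&
     (sym && bitrel r x y ==> bitrel r y x)))) &&
  ball (bitrel_bound m) (fun s =>
    ball N (fun x => bex k (fun i => bitrel s x i)) ==>
    bex N (fun x => bex N (fun y => bex k (fun i =>
      bitrel s x i && (bitrel s y i && bitrel r x y))))).

(* [u] is a set of codes closed under subformulas, and [t] relates each world to the
   codes in [u] of the formulas true there. *)
Definition truth_check (N c r d u t : nat) : bool :=
  ball c.+1 (fun e => bit u e ==> ball N (fun x =>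
    ((e == 0) ==> ~~ bitrel t x e) &&
    ball c.+1 (fun a =>
      ball c.+1 (fun b => (e == 4 * pair_code a b + 2) ==>
        bit u a && (bit u b &&
          (bitrel t x e == (bitrel t x a ==> bitrel t x b)))) &&
      (((e == 4 * a + 3) ==> bit u a &&
        (bitrel t x e == bex N (fun y => bitrel r x y && bitrel t y a))) &&
       ((e == 4 * a + 4) ==> bit u a &&
        (bitrel t x e == bex N (fun y => bitrel d x y && bitrel t y a))))))).

(** The sum [N + c + k] bounds worlds, formula codes and colours together, so one bound serves all
    the coded sets. The outer successor is there because [bex] is strict and [N] may equal
    [2 ^ c.+1]. *)
Definition refutable (sym : bool) (k c : nat) : bool :=
  bex (2 ^ c.+1).+1 (fun N =>
  bex (bitrel_bound (N + c + k)) (fun r =>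
  bex (bitrel_bound (N + c + k)) (fun d =>
  bex (bitrel_bound (N + c + k)) (fun u =>
  bex (bitrel_bound (N + c + k)) (fun t =>
    frame_check sym k N (N + c + k) r d &&
    (truth_check N c r d u t &&
     (bit u c && bex N (fun x => ~~ bitrel t x c)))))))).

Ltac rec_auto :=
  repeat first
    [ apply: rec_ball | apply: rec_bex | apply: rec_and | apply: rec_implb
    | apply: rec_bit | apply: rec_pair | apply: rec_eqb | apply: rec_eqn
    | apply: rec_neg | apply: rec_exp | apply: rec_add | apply: rec_mul
    | apply: rec_S | rec_base ].

Lemma rec_frame_check sym k n (N m r d : n.-tuple nat -> nat) :
  recursive N -> recursive m -> recursive r -> recursive d ->
  recursive (fun v => frame_check sym k (N v) (m v) (r v) (d v)).
Proof.
by move=> rN rm rr rd; rewrite /frame_check /bitrel /bitrel_bound; rec_auto.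
Qed.

Lemma rec_truth_check n (N c r d u t : n.-tuple nat -> nat) :
  recursive N -> recursive c -> recursive r -> recursive d ->
  recursive u -> recursive t ->
  recursive (fun v => truth_check (N v) (c v) (r v) (d v) (u v) (t v)).
Proof.
by move=> rN rc rr rd ru rt; rewrite /truth_check /bitrel; rec_auto.
Qed.

Lemma rec_refutable sym k n (c : n.-tuple nat -> nat) :
  recursive c -> recursive (fun v => refutable sym k (c v)).
Proof.
move=> rc; rewrite /refutable /bitrel_bound /bitrel.
do 5![apply: rec_bex; first by rec_auto].
apply: rec_and; first by apply: rec_frame_check; rec_auto.
apply: rec_and; first by apply: rec_truth_check; rec_auto.
by rec_auto.
Qed.

Definition finitely_refutable (sym : bool) (k m : nat) (a : form bimod) : Prop :=
  exists (X : finType) (r : bimod -> X -> X -> Prop),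
    [/\ #|X| <= m, good sym k r
      & exists (V : nat -> X -> Prop) (x : X), ~ @sat bimod (Frame r) V x a].

Lemma refutable_sound sym k a :
  refutable sym k (code a) -> finitely_refutable sym k (2 ^ (code a).+1) a.
Proof.
move=> /bexP[N leN /bexP[r _ /bexP[d _ /bexP[u _ /bexP[t _]]]]].
case/andP => /andP[/ballP FD /ballP FC] /andP[/ballP T /andP[ua /bexP[x0 x0N nx0]]].
have {}FD (x y : 'I_N) := elimT andP (elimT (ballP _ _) (FD x (ltn_ord x)) y (ltn_ord y)).
pose R m (x y : 'I_N) : Prop := bitrel (if m is ModR then r else d) x y.
exists 'I_N, R; split; first by rewrite card_ord -ltnS.
  split.
  - by move=> x y; have [/implyP s _] := FD x y.
  - move=> x y neq; have [_ /andP[/implyP tot _]] := FD x y; apply: tot.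
    by apply/eqP => /val_inj.
  - move=> symT x y rxy; have [_ /andP[_ /implyP s]] := FD x y; apply: s.
    by rewrite symT.
  move=> c.
  (* The graph of the colouring is coded by a number [s] within the range over which [frame_check]
     quantifies. *)
  have [s sm sP] := bitrel_exist (N + code a + k)
    (fun x i => if insub x is Some x' then c x' == i :> nat else false).
  have sE (x : 'I_N) i : i < k -> bitrel s x i = (c x == i :> nat).
    move=> ik; rewrite sP ?valK //; last by lia.
    by have := ltn_ord x; lia.
  have colored : ball N (fun x => bex k (fun i => bitrel s x i)).
    apply/ballP => x xN; apply/bexP; exists (c (Ordinal xN)) => //.
    by rewrite (sE (Ordinal xN)).
  have /implyP/(_ colored)/bexP[x xN /bexP[y yN /bexP[i ik /and3P[]]]] := FC s sm.
  rewrite (sE (Ordinal xN)) // (sE (Ordinal yN)) // => /eqP cx /eqP cy rxy.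
  by exists (Ordinal xN), (Ordinal yN); split=> //; apply: val_inj; rewrite /= cx.
pose V i (x : 'I_N) : Prop := bitrel t x (code (Var i)).
exists V, (Ordinal x0N).
(* The induction runs over the formulas whose codes are in [u]; the check itself passes membership
   in [u] on to the immediate subformulas. *)
have truth b (x : 'I_N) : code b <= code a -> bit u (code b) ->
    @sat bimod (Frame R) V x b <-> bitrel t x (code b).
  elim: b x => [i||b IHb c IHc|m b IHb] x le ub //.
  - have /implyP/(_ ub)/ballP/(_ x (ltn_ord x))/andP[] := T (code Bot) le.
    by move=> /implyP/(_ erefl)/negP.
  - have := leq_pair_codel (code b) (code c).
    have := leq_pair_coder (code b) (code c).
    move: (le); rewrite [code (Imp _ _)]/= => le' lec leb.
    have bs : code b < (code a).+1 by lia.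
    have cs : code c < (code a).+1 by lia.
    have /implyP/(_ ub)/ballP/(_ x (ltn_ord x))/andP[_] := T _ le.
    move=> /ballP/(_ _ bs)/andP[/ballP/(_ _ cs)/implyP/(_ (eqxx _))] + _.
    move=> /and3P[u1 u2 /eqP ->].
    have {}IHb := IHb x bs u1; have {}IHc := IHc x cs u2.
    by split=> [bc|/implyP bc]; [apply/implyP => /IHb/bc/IHc|move=> /IHb/bc/IHc].
  - have bs : code b < (code a).+1 by case: m le {ub} => /=; lia.
    have /implyP/(_ ub)/ballP/(_ x (ltn_ord x))/andP[_] := T _ le.
    move=> /ballP/(_ _ bs)/andP[_ /andP[/implyP TR /implyP TD]].
    have [u1 ->] : bit u (code b) /\ bitrel t x (code (Dia m b)) =
        bex N (fun y => bitrel (if m is ModR then r else d) x y && bitrel t y (code b)).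
      by case: m {ub le} TR TD => [/(_ (eqxx _))/andP[u1 /eqP]|_ /(_ (eqxx _))/andP[u1 /eqP]].
    split=> [[y xy /IHb yb]|/bexP[y yN /andP[xy ty]]].
      by apply/bexP; exists y => //; rewrite [bitrel _ _ _]xy; apply: yb.
    by exists (Ordinal yN) => //; apply/IHb.
by move=> /truth; rewrite leqnn => /(_ isT ua); apply/negP.
Qed.

(** Codes increase along the subformula order because [pair_code] dominates both arguments; so
    quantifiers up to [c] in [truth_check] reach every subformula. *)
Lemma code_subform a b : b \in subforms a -> code b <= code a.
Proof.
elim: a => [i||c IHc d IHd|m c IHc] /=; rewrite in_cons ?mem_cat.
- by rewrite orbF => /eqP->.
- by rewrite orbF => /eqP->.
- have := leq_pair_codel (code c) (code d).
  have := leq_pair_coder (code c) (code d).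
  by move=> h1 h2 /or3P[/eqP->//|/IHc|/IHd]; lia.
- by case/orP => [/eqP->//|/IHc]; case: m; lia.
Qed.

Lemma refutable_complete sym k a :
  finitely_refutable sym k (2 ^ (code a).+1) a -> refutable sym k (code a).
Proof.
case=> X [r [cardX gr [V [x0 nx0]]]].
(* Worlds are renamed by their position in [enum X]; the refuting point [x0] is the default of
   [nth]. *)
pose N := #|X|; pose w i := nth x0 (enum X) i; pose idx y := index y (enum X).
have wK y : w (idx y) = y by rewrite /w nth_index ?mem_enum.
have idxN y : idx y < N by rewrite /N cardE index_mem mem_enum.
set m := N + code a + k.
have [rR rRm rRP] := bitrel_exist m (fun x y => `[< r ModR (w x) (w y) >]).
have [rD rDm rDP] := bitrel_exist m (fun x y => `[< r ModD (w x) (w y) >]).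
have [u um uP] := bits_exist (pair_code m m).+1
  (fun e => `[< exists2 b, b \in subforms a & code b = e >]).
have [t tm tP] := bitrel_exist m (fun x e =>
  `[< exists2 b, code b = e & @sat bimod (Frame r) V (w x) b >]).
have Nm x : x < N -> x <= m by rewrite /m; lia.
have cm e : e < (code a).+1 -> e <= m by rewrite /m; lia.
have RP x y : x < N -> y < N -> reflect (r ModR (w x) (w y)) (bitrel rR x y).
  by move=> xN yN; rewrite rRP ?Nm //; apply: asboolP.
have DP x y : x < N -> y < N -> reflect (r ModD (w x) (w y)) (bitrel rD x y).
  by move=> xN yN; rewrite rDP ?Nm //; apply: asboolP.
have TP x b : x < N -> b \in subforms a ->
    reflect (@sat bimod (Frame r) V (w x) b) (bitrel t x (code b)).
  move=> xN ab; have lem : code b <= m by apply: cm; rewrite ltnS code_subform.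
  rewrite (tP _ _ (Nm _ xN) lem).
  by apply: (iffP (asboolP _)) => [[b' /code_inj ->]//|]; exists b.
have uE : {in subforms a, forall b, bit u (code b)}.
  move=> b ab; rewrite uP; first by apply/asboolP; exists b.
  rewrite ltnS; apply: leq_trans (leq_pair_codel m m).
  by apply: cm; rewrite ltnS code_subform.
apply/bexP; exists N; first by rewrite ltnS.
apply/bexP; exists rR => //; apply/bexP; exists rD => //.
apply/bexP; exists u => //; apply/bexP; exists t => //.
apply/and4P; split.
- apply/andP; split; apply/ballP.
    move=> x xN; apply/ballP => y yN; apply/and3P; split; apply/implyP.
    + by move=> /(DP x y xN yN)/(good_Dsym gr)/(DP y x yN xN).
    + move=> neq; apply/DP => //; apply: (good_Dtotal gr) => /eqP.
      by rewrite nth_uniq ?enum_uniq -?cardE // (negbTE neq).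
    + by move=> /andP[symT /(RP x y xN yN)/(good_Rsym gr symT)/(RP y x yN xN)].
  move=> s _; apply/implyP => /ballP sc.
  (* The number [s] may give a world several colours; one of them is chosen. *)
  have /choice[c cP] : forall y, exists i : 'I_k, bitrel s (idx y) i.
    by move=> y; have /bexP[i ik si] := sc _ (idxN y); exists (Ordinal ik).
  have [x [y [xy cxy]]] := good_col gr c.
  apply/bexP; exists (idx x) => //; apply/bexP; exists (idx y) => //.
  apply/bexP; exists (c x) => //; rewrite cP cxy cP /=.
  by apply/RP; rewrite ?wK.
- apply/ballP => e ea; apply/implyP; rewrite uP; last first.
    by rewrite ltnS; apply: leq_trans (leq_pair_codel m m); apply: cm.
  move=> /asboolP[b ab be]; apply/ballP => x xN; apply/andP; split.
    apply/implyP => /eqP e0; rewrite e0; apply/negP => tx.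
    have bB : b = Bot by apply: code_inj; rewrite be e0.
    by move: ab; rewrite bB => ab; move: tx => /(TP x Bot xN ab).
  (* Three clauses are tested against the four shapes of [b]; residues of codes modulo 4, with 0
     kept for [Bot], exclude all but the matching shape. *)
  apply/ballP => p _; apply/andP; split; [apply/ballP => q _|apply/andP; split];
    apply/implyP => /eqP; rewrite -be; case: b {be} ab.
  + by move=> i ab /=; lia.
  + by move=> ab /=; lia.
  + move=> b c ab /= h.
    have /pair_code_inj[<- <-] : pair_code (code b) (code c) = pair_code p q by lia.
    have /andP[bs cs] := subforms_imp ab.
    rewrite !uE //=; apply/eqP; apply/(TP x (Imp b c) xN ab)/implyP.
      by move=> bc /(TP x b xN bs)/bc/(TP x c xN cs).
    by move=> bc /(TP x b xN bs)/bc/(TP x c xN cs).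
  + by case=> b ab /=; lia.
  + by move=> i ab /=; lia.
  + by move=> ab /=; lia.
  + by move=> b c ab /=; lia.
  + case=> b ab /= h; last by lia.
    have <- : code b = p by lia.
    have bs := subforms_dia ab; rewrite uE //=; apply/eqP.
    apply/(TP x (Dia ModR b) xN ab)/bexP.
      move=> [y xy yb]; exists (idx y) => //; apply/andP; split.
        by apply/RP => //; rewrite wK.
      by apply/TP => //; rewrite wK.
    by move=> [y yN /andP[/(RP x y xN yN) xy /(TP y b yN bs)]]; exists (w y).
  + by move=> i ab /=; lia.
  + by move=> ab /=; lia.
  + by move=> b c ab /=; lia.
  + case=> b ab /= h; first by lia.
    have <- : code b = p by lia.
    have bs := subforms_dia ab; rewrite uE //=; apply/eqP.
    apply/(TP x (Dia ModD b) xN ab)/bexP.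
      move=> [y xy yb]; exists (idx y) => //; apply/andP; split.
        by apply/DP => //; rewrite wK.
      by apply/TP => //; rewrite wK.
    by move=> [y yN /andP[/(DP x y xN yN) xy /(TP y b yN bs)]]; exists (w y).
- exact: uE (mem_subforms_refl a).
apply/bexP; exists (idx x0) => //; apply/TP => //; last by rewrite wK.
exact: mem_subforms_refl.
Qed.

(** * From refuting frames to the finite model property and decidability *)

(** Distinct subformulas have distinct codes, all at most [code a]. This turns the model bound into
    one computable from the code alone. *)
Lemma num_subforms_code a : num_subforms a <= (code a).+1.
Proof.
rewrite /num_subforms -(size_map code) -(size_iota 0 (code a).+1).
apply: uniq_leq_size; first by rewrite map_inj_uniq ?undup_uniq //; apply: code_inj.
move=> _ /mapP[b + ->]; rewrite mem_undup mem_iota /= => /code_subform; lia.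
Qed.

Lemma finitely_refutable_chi_logic sym k m a :
  finitely_refutable sym k m a -> ~ chi_logic sym k a.
Proof.
by case=> X [r [_ gr [V [x nx]]]] /(good_validates gr)/(_ V x).
Qed.

Lemma chi_logic_exponential_fmp sym k : exponential_fmp (chi_logic sym k).
Proof.
move=> a /chi_logic_fmp[X [r [cX gr nV]]].
by exists X, r; split=> //; apply: good_validates gr.
Qed.

Lemma chi_logic_decidable sym k : decidable_logic (chi_logic sym k).
Proof.
exists (fun v => ~~ refutable sym k (thead v)).
  by apply: rec_neg; apply: rec_refutable; rec_base.
move=> a; rewrite theadE; split=> [La|nLa].
  have : ~~ refutable sym k (code a).
    by apply/negP => /refutable_sound/finitely_refutable_chi_logic.
  by move=> ->.
(* The remaining goal is a refuting frame within the search bound, which the finite model property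
   provides. *)
rewrite refutable_complete //.
have [X [r [cX gr nV]]] := chi_logic_fmp nLa; exists X, r; split=> //.
by apply: leq_trans cX _; rewrite leq_exp2l // num_subforms_code.
Qed.

Theorem theorem1 (k : nat) :
  (exponential_fmp (plus (neq_logic logicK) (eq (chi k))) /\
   decidable_logic (plus (neq_logic logicK) (eq (chi k)))) /\
  (exponential_fmp (plus (neq_logic logicKB) (eq (chi k))) /\
   decidable_logic (plus (neq_logic logicKB) (eq (chi k)))).
Proof.
split; split.
- exact: (chi_logic_exponential_fmp (sym := false)).
- exact: (chi_logic_decidable false).
- exact: (chi_logic_exponential_fmp (sym := true)).
- exact: (chi_logic_decidable true).
Qed.
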